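(* Let $K=\{0,1,2\}$ (i.e. $k=3$). If $f\in G_{2,3}^3$, then, up to a permutation of the variables $x_1,x_2,x_3$, $f$ can be represented in one of the following forms: $$f=\bigoplus_{i=0}^{2}a^{(i)}\big[x_3^i\, s(x_1,x_2)\oplus x_2^i\, u^{(i)}(x_1,x_3)\oplus x_1^i\, u^{(i)}(x_2,x_3)\big]\oplus p_3(x_1,x_2,x_3),$$ $$f=\bigoplus_{i=0}^{2}a^{(i)}\big[x_1^i x_2^i\oplus x_1^i\, u^{(i)}(x_2,x_3)\oplus x_2^i\, u^{(i)}(x_1,x_3)\big]\oplus p_3(x_1,x_2,x_3),$$ $$f=\bigoplus_{i=0}^{2}a^{(i)}\big[x_1^i x_2^i\oplus x_2^i\, v^{(i)}(x_3,x_1)\oplus x_2^i\, u^{(i)}(x_1,x_3)\big]\oplus p_3(x_1,x_2,x_3),$$ $$f=\bigoplus_{i=0}^{2}a^{(i)}\big[x_1^i x_2^i\oplus x_1^i\, v^{(i)}(x_3,x_2)\oplus x_2^i\, v^{(i)}(x_3,x_1)\big]\oplus p_3(x_1,x_2,x_3),$$ where $a^{(0)},a^{(1)},a^{(2)}\in K$ are constants of which at least two are different, and $p_3$ is a function of the form $p_3(x_1,x_2,x_3)=\bigoplus_{\alpha_1\alpha_2\alpha_3\in K^3\setminus Eq_3^3} c_{\alpha}\, x_1^{\alpha_1}x_2^{\alpha_2}x_3^{\alpha_3}$ with arbitrary constants $c_\alpha\in K$.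
   Context: $K=\{0,1,2\}$ is the ring of residues modulo $3$; $\oplus$ and juxtaposition denote addition and multiplication modulo $3$. For a variable $x$ and $\alpha\in K$, $x^\alpha=1$ if $x=\alpha$ and $0$ otherwise. Auxiliary functions: $s(y,z)=\bigoplus_{\beta\in K}y^\beta z^\beta$; $u^{(\alpha)}(y,z)=\bigoplus_{\beta\neq\alpha}y^\beta z^\beta$; $v^{(\alpha)}(y,z)=\bigoplus_{\beta\neq\alpha}y^\alpha z^\beta$. $Eq_3^3$ is the set of strings $\alpha_1\alpha_2\alpha_3\in K^3$ with $\alpha_i=\alpha_j$ for some $i\neq j$. $P_3^3$ is the set of functions $K^3\to K$ in variables $x_1,x_2,x_3$. A variable $x_i$ is essential in $g$ if changing only the $i$-th argument can change the value of $g$; $ess(g)$ is the number of essential variables. For $i\neq j$, $g_{i\leftarrow j}$ is $g$ with the $i$-th argument replaced by the $j$-th argument. $Min(g)$ is the set of all $g_{i\leftarrow j}$ with $i\neq j$ and $x_i,x_j$ essential in $g$; $gap(g)=ess(g)-\max_{t\in Min(g)}ess(t)$. $G_{2,3}^3=\{f\in P_3^3: ess(f)=3,\ gap(f)=2\}$. *)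

(* Defs.v *)
From mathcomp Require Import all_boot all_order all_algebra all_fingroup.
Set Implicit Arguments.
Unset Strict Implicit.
Unset Printing Implicit Defensive.
Import GRing.Theory.
Local Open Scope ring_scope.

Notation K := 'Z_3.

Notation string n := {ffun 'I_n -> K}.

(** The n-ary functions K^n -> K; Leibniz equality on this type is
    extensional, so sets of functions are finite sets [{set P3 n}]. *)
Notation P3 n := {ffun string n -> K}.

Section Minors.
Variable n : nat.
Implicit Types (g : P3 n) (x : string n) (i j : 'I_n).

Definition set_arg x i (b : K) : string n :=
  [ffun l => if l == i then b else x l].

Definition essential g i : bool :=
  [exists x : string n, exists b : K, g (set_arg x i b) != g x].

Definition Ess g : {set 'I_n} := [set i | essential g i].

Definition ess g : nat := #|Ess g|.

(** [minor g i j] is g_{i <- j}: the i-th argument is replaced by the j-th. *)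
Definition minor g i j : P3 n := [ffun x => g (set_arg x i (x j))].

Definition Min g : {set P3 n} :=
  [set minor g i j | i in Ess g, j in Ess g & i != j].

(** If [Min g] is empty the maximum is 0; this does not occur when
    [2 <= ess g].  The truncated subtraction is exact, as a minor of [g] has at
    most [ess g] essential variables. *)
Definition gap g : nat := (ess g - \max_(t in Min g) ess t)%N.

End Minors.

Definition G233 : {set P3 3} := [set f : P3 3 | (ess f == 3) && (gap f == 2)].

(** [lit x alpha] is x^alpha: 1 if x = alpha, and 0 otherwise. *)
Definition lit (x alpha : K) : K := if x == alpha then 1 else 0.

Definition s (y z : K) : K := \sum_(b : K) lit y b * lit z b.

Definition u (alpha y z : K) : K :=
  \sum_(b : K | b != alpha) lit y b * lit z b.

Definition v (alpha y z : K) : K :=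
  \sum_(b : K | b != alpha) lit y alpha * lit z b.

Definition Eq33 : {set string 3} :=
  [set al : string 3 | [exists i, exists j, (i != j) && (al i == al j)]].

(** The positions of x_1, x_2, x_3 among the 0-based indices of 'I_3. *)
Definition i1 : 'I_3 := @Ordinal 3 0 isT.
Definition i2 : 'I_3 := @Ordinal 3 1 isT.
Definition i3 : 'I_3 := @Ordinal 3 2 isT.

Definition p3 (c : string 3 -> K) (x1 x2 x3 : K) : K :=
  \sum_(al : string 3 | al \notin Eq33)
     c al * (lit x1 (al i1) * lit x2 (al i2) * lit x3 (al i3)).

Definition form1 (a : K -> K) (c : string 3 -> K) (x1 x2 x3 : K) : K :=
  \sum_(i : K) a i * (lit x3 i * s x1 x2 + lit x2 i * u i x1 x3
                      + lit x1 i * u i x2 x3)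
  + p3 c x1 x2 x3.

Definition form2 (a : K -> K) (c : string 3 -> K) (x1 x2 x3 : K) : K :=
  \sum_(i : K) a i * (lit x1 i * lit x2 i + lit x1 i * u i x2 x3
                      + lit x2 i * u i x1 x3)
  + p3 c x1 x2 x3.

Definition form3 (a : K -> K) (c : string 3 -> K) (x1 x2 x3 : K) : K :=
  \sum_(i : K) a i * (lit x1 i * lit x2 i + lit x2 i * v i x3 x1
                      + lit x2 i * u i x1 x3)
  + p3 c x1 x2 x3.

Definition form4 (a : K -> K) (c : string 3 -> K) (x1 x2 x3 : K) : K :=
  \sum_(i : K) a i * (lit x1 i * lit x2 i + lit x1 i * v i x3 x2
                      + lit x2 i * v i x3 x1)
  + p3 c x1 x2 x3.

(** f is obtained from F by a permutation of the variables. *)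
Definition up_to_perm (f : P3 3) (F : K -> K -> K -> K) : Prop :=
  exists sg : 'S_3, forall x : string 3,
    f x = F (x (sg i1)) (x (sg i2)) (x (sg i3)).

(* Main.v *)
Require Import Defs.
From mathcomp Require Import all_boot all_order all_algebra all_fingroup.
Set Implicit Arguments.
Unset Strict Implicit.
Unset Printing Implicit Defensive.
Import GRing.Theory.
Local Open Scope ring_scope.

(** Let [a y = f(y,y,y)].  As no minor of [f] has two essential variables, on
    the strings with [x_i = x_j] the function [f] depends on a single argument,
    hence equals either [a] of the repeated letter or [a] of the remaining one.
    These three binary choices, one for each pair [{i, j}], determine [f] on
    [Eq33], and up to a permutation of the variables only the number of pairs
    with the first alternative (0, 1, 2 or 3) matters: this gives the four
    forms.  If [a] were constant, all minors would be constant and the gap would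
    be 3. *)

(** * Inessential variables and minors *)

Section Essential.
Variable n : nat.
Implicit Types (g : P3 n) (i j : 'I_n).

Lemma essentialPn g i :
  reflect (forall x b, g (set_arg x i b) = g x) (~~ essential g i).
Proof.
apply: (iffP idP) => [|gi].
  by move=> /existsPn gi x b; have /existsPn/(_ b)/negPn/eqP := gi x.
by apply/existsPn => x; apply/existsPn => b; rewrite gi eqxx.
Qed.

Lemma ess_leq1 g i j : (ess g <= 1)%N -> i != j ->
  ~~ essential g i \/ ~~ essential g j.
Proof.
move=> /card_le1P g1 ij; case: (boolP (essential g i)) => gi; last by left.
right; apply/negP => gj.
have := g1 i; rewrite inE => /(_ gi j); rewrite !inE gj => /esym/eqP ji.
by rewrite ji eqxx in ij.
Qed.

Lemma mem_Min g i j : i \in Ess g -> j \in Ess g -> i != j ->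
  minor g i j \in Min g.
Proof. by move=> gi gj ij; apply/imset2P; exists i j; rewrite // inE gj ij. Qed.

End Essential.

Lemma ord3_cover (i j k l : 'I_3) : i != j -> i != k -> j != k ->
  [|| l == i, l == j | l == k].
Proof.
by case: i j k l => [[|[|[|?]]] ?] [[|[|[|?]]] ?] [[|[|[|?]]] ?] [[|[|[|?]]] ?].
Qed.

Definition diag (f : P3 3) (y : K) : K := f [ffun=> y].

(** Each pair is indexed by the variable [k] outside it; [d k] is true when the repeated letter
    decides the value. *)
Definition determined_by (f : P3 3) (d : 'I_3 -> bool) :=
  forall i j k, i != j -> i != k -> j != k ->
  forall x : string 3, x i = x j -> f x = diag f (if d k then x j else x k).

(** * Functions of gap two on strings with a repeated letter *)

Section GapTwo.
Variable f : P3 3.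
Hypothesis hf : f \in G233.

Lemma G233_Ess i : i \in Ess f.
Proof.
move: hf; rewrite inE => /andP[/eqP ess3 _].
suff -> : Ess f = setT by rewrite inE.
by apply/eqP; rewrite eqEcard subsetT cardsT card_ord (_ : (3 <= ess f)%N) ?ess3.
Qed.

Lemma G233_bigmax : (\max_(t in Min f) ess t = 1)%N.
Proof.
move: hf; rewrite inE /gap => /andP[/eqP-> /eqP].
by case: (\max_(t in _) _)%N => [|[|[|[|m]]]].
Qed.

Lemma G233_minor i j k : i != j -> i != k -> j != k ->
  exists b : bool, forall x : string 3, x i = x j ->
    f x = diag f (if b then x j else x k).
Proof.
move=> ij ik jk.
have le1 : (ess (minor f i j) <= 1)%N.
  apply: leq_trans (eq_leq G233_bigmax); apply: (@leq_bigmax_cond _ _ (@ess 3)).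
  by apply: mem_Min; rewrite ?G233_Ess.
have minorE (x : string 3) : x i = x j -> f x = minor f i j x.
  move=> xij; rewrite ffunE; congr (f _); apply/ffunP => l.
  by rewrite ffunE; case: eqP => // ->.
(* If [j] is inessential in the minor, overwriting argument [j] by [x k] makes [f] read the constant
   string [x k]; if [k] is inessential, overwriting it by [x j] gives the constant string [x j]. *)
case: (ess_leq1 le1 jk) => /essentialPn inv; [exists false | exists true];
  move=> x /minorE->.
- rewrite -(inv x (x k)) ffunE; congr (f _); apply/ffunP => l; rewrite !ffunE.
  by case/or3P: (ord3_cover l ij ik jk) => /eqP->; rewrite ?eqxx //;
     do 2![case: eqP => //].
- rewrite -(inv x (x j)) ffunE; congr (f _); apply/ffunP => l; rewrite !ffunE.
  rewrite (negPf jk); case/or3P: (ord3_cover l ij ik jk) => /eqP->.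
  + by rewrite eqxx.
  + by rewrite (negPf jk) if_same.
  + by rewrite eqxx if_same.
Qed.

Lemma G233_determined : exists d, determined_by f d.
Proof.
suff /fin_all_exists[d dP] : forall k, exists b : bool, forall i j,
    i != j -> i != k -> j != k ->
    forall x : string 3, x i = x j -> f x = diag f (if b then x j else x k).
  by exists d => i j k; apply: dP.
move=> k.
have [i [j [ij ik jk]]] : exists i j, [/\ i != j, i != k & j != k].
  by case: k => [[|[|[|?]]] lt_k] //;
     [exists i2, i3 | exists i1, i3 | exists i1, i2].
have [b bP] := G233_minor ij ik jk.
exists b => i' j' ij' ik' jk' x xij'.
(* Both pairs avoid [k], so they agree up to order, which is irrelevant once the two letters are
   equal. *)
have xij : x i = x j.
  case/or3P: (ord3_cover i ij' ik' jk') => /eqP Ei; rewrite ?Ei in ik ij *;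
  case/or3P: (ord3_cover j ij' ik' jk') => /eqP Ej; rewrite ?Ej in jk ij *;
  by rewrite ?eqxx in ij ik jk.
rewrite (bP x xij); congr (diag f (if b then _ else _)).
by case/or3P: (ord3_cover j ij' ik' jk') => /eqP Ej;
   rewrite Ej ?xij' // in jk *; rewrite eqxx in jk.
Qed.

Lemma G233_diag_neq : exists y z : K, diag f y <> diag f z.
Proof.
have [d dP] := G233_determined.
(* Boolean quantifiers over the finite [K] allow a proof by contradiction. *)
suff /existsP[y /existsP[z /eqP yz]] :
    [exists y, exists z, diag f y != diag f z].
  by exists y, z.
apply: contraT => /existsPn diag_cst.
have cst y z : diag f y = diag f z.
  by have /existsPn/(_ z)/negPn/eqP := diag_cst y.
suff : (\max_(t in Min f) ess t <= 0)%N by rewrite G233_bigmax.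
apply/bigmax_leqP => _ /imset2P[i j _ + ->]; rewrite inE => /andP[_ ij].
have [k [ik jk]] : exists k, i != k /\ j != k.
  case: i j ij => [[|[|[|?]]] ?] [[|[|[|?]]] ?] //= _;
  by [exists i1 | exists i2 | exists i3].
have minor_cst x : minor f i j x = diag f 0.
  by rewrite ffunE (dP i j k) ?ffunE ?eqxx ?[j == i]eq_sym ?(negPf ij).
rewrite leqn0 cards_eq0; apply/eqP/setP => l; rewrite !inE.
by apply/negbTE/essentialPn => x b; rewrite !minor_cst.
Qed.

End GapTwo.

(** * Pointwise values of the auxiliary functions and of [p3] *)

Lemma litE x y : lit x y = (x == y)%:R.
Proof. by rewrite /lit; case: eqP. Qed.

Lemma sum_lit (P : pred K) (F : K -> K) x :
  \sum_(i | P i) F i * lit x i = if P x then F x else 0.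
Proof.
rewrite big_mkcond (bigD1 x) //= big1 ?addr0 => [|i ix].
  by rewrite litE eqxx mulr1.
by rewrite litE eq_sym (negPf ix) mulr0 if_same.
Qed.

Lemma sE y z : s y z = (y == z)%:R.
Proof. by rewrite /s sum_lit litE. Qed.

Lemma uE b y z : u b y z = ((y == z) && (z != b))%:R.
Proof. by rewrite /u sum_lit litE; case: (z != b); rewrite ?andbT ?andbF. Qed.

Lemma vE b y z : v b y z = ((y == b) && (z != b))%:R.
Proof. by rewrite /v sum_lit litE; case: (z != b); rewrite ?andbT ?andbF. Qed.

Definition string3 (x1 x2 x3 : K) : string 3 :=
  [ffun l => if l == i1 then x1 else if l == i2 then x2 else x3].

Lemma mem_Eq33 al : (al \in Eq33) =
  [|| al i1 == al i2, al i1 == al i3 | al i2 == al i3].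
Proof.
rewrite inE; apply/existsP/or3P => [[i /existsP[j /andP[ij /eqP alij]]]|].
  have ordE (l : 'I_3) : [|| l == i1, l == i2 | l == i3] by apply: ord3_cover.
  move: ij alij.
  case/or3P: (ordE i) => /eqP->; case/or3P: (ordE j) => /eqP-> // _ ->;
  by [constructor 1 | constructor 2 | constructor 3].
by case=> e; [exists i1 | exists i1 | exists i2]; apply/existsP;
   [exists i2 | exists i3 | exists i3].
Qed.

(** A product of three literals is nonzero only at the string of its arguments, and this string is
    an index of the sum only if its letters are distinct. *)
Lemma p3E c x1 x2 x3 : p3 c x1 x2 x3 =
  if [|| x1 == x2, x1 == x3 | x2 == x3] then 0 else c (string3 x1 x2 x3).
Proof.
have memE : (string3 x1 x2 x3 \in Eq33) = [|| x1 == x2, x1 == x3 | x2 == x3].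
  by rewrite mem_Eq33 !ffunE.
rewrite /p3 big_mkcond (bigD1 (string3 x1 x2 x3)) //= big1 => [|al al_neq].
  by rewrite memE if_neg addr0 !litE !ffunE !eqxx !mulr1.
case: ifP => // _; rewrite !litE -!natrM !mulnb.
case: andP => [[/andP[]]|]; last by rewrite mulr0.
move=> /eqP e1 /eqP e2 /eqP e3; case/eqP: al_neq.
apply/ffunP => l; rewrite ffunE e1 e2 e3.
have : [|| l == i1, l == i2 | l == i3] by apply: ord3_cover.
by case/or3P => /eqP->.
Qed.

(** [d1], [d2], [d3] tell, for the pair of variables not containing [x1], [x2],
    [x3] respectively, whether the repeated letter is the relevant one. *)
Definition normal_form (d1 d2 d3 : bool) (a : K -> K) (c : string 3 -> K)
    (x1 x2 x3 : K) : K :=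
  if x1 == x2 then a (if d3 then x2 else x3)
  else if x1 == x3 then a (if d2 then x3 else x2)
  else if x2 == x3 then a (if d1 then x3 else x1)
  else c (string3 x1 x2 x3).

Lemma sum_coef (a : K -> K) (F : K -> K) x :
  \sum_i a i * (lit x i * F i) = a x * F x.
Proof.
by under eq_bigr => i _ do rewrite [lit x i * _]mulrC mulrA; rewrite sum_lit.
Qed.

(** The first three hypotheses overlap only on constant strings, where each gives [a y]; so the
    order of the tests in [normal_form] is harmless. *)
Lemma eq_normal_form d1 d2 d3 a c (F : K -> K -> K -> K) :
    (forall y z, F y y z = a (if d3 then y else z)) ->
    (forall y z, F y z y = a (if d2 then y else z)) ->
    (forall y z, F z y y = a (if d1 then y else z)) ->
    (forall x1 x2 x3, x1 != x2 -> x1 != x3 -> x2 != x3 ->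
       F x1 x2 x3 = c (string3 x1 x2 x3)) ->
  forall x1 x2 x3, F x1 x2 x3 = normal_form d1 d2 d3 a c x1 x2 x3.
Proof.
move=> F12 F13 F23 Fc x1 x2 x3; rewrite /normal_form.
have [->|n12] := eqVneq x1 x2; first exact: F12.
have [->|n13] := eqVneq x1 x3; first exact: F13.
have [->|n23] := eqVneq x2 x3; first exact: F23.
exact: Fc.
Qed.

Lemma sum_coef3 (a F G H : K -> K) x y z :
  \sum_i a i * (lit x i * F i + lit y i * G i + lit z i * H i) =
  a x * F x + a y * G y + a z * H z.
Proof.
by under eq_bigr => i _ do rewrite !mulrDr; rewrite !big_split /= !sum_coef.
Qed.

(** With a repeated letter exactly one of the three collapsed terms survives and [p3] vanishes; with
    distinct letters only [p3] remains. The other forms are evaluated in the same way. *)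
Lemma form1E a c x1 x2 x3 :
  form1 a c x1 x2 x3 = normal_form false false false a c x1 x2 x3.
Proof.
move: x1 x2 x3.
apply: eq_normal_form => [y z|y z|y z|x1 x2 x3 /negPf n12 /negPf n13 /negPf n23];
  rewrite /form1 sum_coef3 ?litE ?sE ?uE ?vE p3E.
1-3: by have [->|_] := eqVneq y z;
  rewrite ?eqxx /= ?mulr0 ?mulr1 ?addr0 ?add0r.
by rewrite ?[x3 == _]eq_sym ?[x2 == x1]eq_sym n12 n13 n23 /= !mulr0 !add0r.
Qed.

Lemma form2E a c x1 x2 x3 :
  form2 a c x1 x2 x3 = normal_form false false true a c x1 x2 x3.
Proof.
move: x1 x2 x3.
apply: eq_normal_form => [y z|y z|y z|x1 x2 x3 /negPf n12 /negPf n13 /negPf n23];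
  rewrite /form2 sum_coef3 ?litE ?sE ?uE ?vE p3E.
1-3: by have [->|_] := eqVneq y z;
  rewrite ?eqxx /= ?mulr0 ?mulr1 ?addr0 ?add0r.
by rewrite ?[x3 == _]eq_sym ?[x2 == x1]eq_sym n12 n13 n23 /= !mulr0 !add0r.
Qed.

Lemma form3E a c x1 x2 x3 :
  form3 a c x1 x2 x3 = normal_form true false true a c x1 x2 x3.
Proof.
move: x1 x2 x3.
apply: eq_normal_form => [y z|y z|y z|x1 x2 x3 /negPf n12 /negPf n13 /negPf n23];
  rewrite /form3 sum_coef3 ?litE ?sE ?uE ?vE p3E.
1-3: by have [->|_] := eqVneq y z;
  rewrite ?eqxx /= ?mulr0 ?mulr1 ?addr0 ?add0r.
by rewrite ?[x3 == _]eq_sym ?[x2 == x1]eq_sym n12 n13 n23 /= !mulr0 !add0r.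
Qed.

Lemma form4E a c x1 x2 x3 :
  form4 a c x1 x2 x3 = normal_form true true true a c x1 x2 x3.
Proof.
move: x1 x2 x3.
apply: eq_normal_form => [y z|y z|y z|x1 x2 x3 /negPf n12 /negPf n13 /negPf n23];
  rewrite /form4 sum_coef3 ?litE ?sE ?uE ?vE p3E.
1-3: by have [->|_] := eqVneq y z;
  rewrite ?eqxx /= ?mulr0 ?mulr1 ?addr0 ?add0r.
by rewrite ?[x3 == _]eq_sym ?[x2 == x1]eq_sym n12 n13 n23 /= !mulr0 !add0r.
Qed.

Lemma determined_normal_form f d (sg : 'S_3) : determined_by f d ->
  exists c, forall x : string 3, f x =
    normal_form (d (sg i1)) (d (sg i2)) (d (sg i3)) (diag f) c
      (x (sg i1)) (x (sg i2)) (x (sg i3)).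
Proof.
(* On distinct letters nothing constrains [f], so [c] is [f] itself read in the permuted
   coordinates. *)
move=> dP; exists (fun al => f [ffun l => al (sg^-1%g l)]) => x.
rewrite /normal_form.
have [e|_] := eqVneq; first by apply: dP e; rewrite inj_eq //; apply: perm_inj.
have [e|_] := eqVneq; first by apply: dP e; rewrite inj_eq //; apply: perm_inj.
have [e|_] := eqVneq; first by apply: dP e; rewrite inj_eq //; apply: perm_inj.
congr (f _); apply/ffunP => l; rewrite !ffunE -{1}(permKV sg l).
have : [|| sg^-1%g l == i1, sg^-1%g l == i2 | sg^-1%g l == i3].
  by apply: ord3_cover.
by case/or3P => /eqP->.
Qed.

Theorem theorem5p2 (f : P3 3) (hf : f \in G233) :
  exists (a : K -> K) (c : string 3 -> K),
    (exists i j : K, a i <> a j) /\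
    [\/ up_to_perm f (form1 a c),
        up_to_perm f (form2 a c),
        up_to_perm f (form3 a c) |
        up_to_perm f (form4 a c)].
Proof.
have [d dP] := G233_determined hf; exists (diag f).
have nf sg := determined_normal_form sg dP.
(* The identity and the transpositions suffice: a single true choice must be moved to position [i3]
   for [form2], a single false one to [i2] for [form3]. *)
have [c1 h1] := nf 1%g; have [c12 h12] := nf (tperm i1 i2).
have [c13 h13] := nf (tperm i1 i3); have [c23 h23] := nf (tperm i2 i3).
have neq := G233_diag_neq hf.
case d1 : (d i1); case d2 : (d i2); case d3 : (d i3).
- exists c1; split=> //; constructor 4; exists 1%g => x.
  by rewrite form4E h1 !perm1 d1 d2 d3.
- exists c23; split=> //; constructor 3; exists (tperm i2 i3) => x.
  by rewrite form3E h23 !permE /= d1 d2 d3.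
- exists c1; split=> //; constructor 3; exists 1%g => x.
  by rewrite form3E h1 !perm1 d1 d2 d3.
- exists c13; split=> //; constructor 2; exists (tperm i1 i3) => x.
  by rewrite form2E h13 !permE /= d1 d2 d3.
- exists c12; split=> //; constructor 3; exists (tperm i1 i2) => x.
  by rewrite form3E h12 !permE /= d1 d2 d3.
- exists c23; split=> //; constructor 2; exists (tperm i2 i3) => x.
  by rewrite form2E h23 !permE /= d1 d2 d3.
- exists c1; split=> //; constructor 2; exists 1%g => x.
  by rewrite form2E h1 !perm1 d1 d2 d3.
- exists c1; split=> //; constructor 1; exists 1%g => x.
  by rewrite form1E h1 !perm1 d1 d2 d3.
Qed.
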